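(* Let $M$ be a mixed graph of order $n$ with vertex set $\{v_1,\dots,v_n\}$ and Hermitian-Randić matrix $R_H(M)$. Then $$\det R_H(M)=\sum_{M'}(-1)^{r(M')+l(M')}\,2^{s(M')}\,W(M'),$$ where the summation is over all real spanning elementary subgraphs $M'$ of $M$, $r(M')=n-c(M')$ with $c(M')$ the number of components of $M'$, $l(M')$ is the number of negative mixed cycles of $M'$, $s(M')$ is the number of mixed cycles of length $\ge 3$ in $M'$, and $W(M')=\prod_{v_i\in V(M')}\frac{1}{d_{M_U}(v_i)}$.
   Context: A mixed graph $M$ is obtained from a simple undirected graph $M_U$ (its underlying graph) by orienting a subset of its edges; thus each edge of $M_U$ is either an undirected edge $v_kv_l$ or an arc $(v_k,v_l)$ of $M$. The degree $d_k=d(v_k)$ of $v_k$ is its degree in $M_U$. The Hermitian-Randić matrix $R_H(M)=((r_h)_{kl})$ is the $n\times n$ matrix with $(r_h)_{kl}=(r_h)_{lk}=\frac{1}{\sqrt{d_kd_l}}$ if $v_kv_l$ is an undirected edge, $(r_h)_{kl}=-(r_h)_{lk}=\frac{\mathrm{i}}{\sqrt{d_kd_l}}$ ($\mathrm{i}=\sqrt{-1}$) if $(v_k,v_l)$ is an arc, and $(r_h)_{kl}=0$ otherwise. For a mixed cycle $C=v_1v_2\cdots v_lv_1$ (a cycle of $M_U$ of length $\ge 3$ traversed in a direction), its value is $(r_h)_{12}(r_h)_{23}\cdots(r_h)_{l1}$, which equals $\epsilon\prod_{v_j\in V(C)}\frac{1}{d(v_j)}$ with $\epsilon\in\{1,-1,\mathrm{i},-\mathrm{i}\}$;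 reversing direction conjugates the value. The cycle is real if its value is real, positive if its value is $\prod_{v_j\in V(C)}\frac{1}{d(v_j)}$ and negative if its value is $-\prod_{v_j\in V(C)}\frac{1}{d(v_j)}$. An elementary graph is a mixed graph each of whose components is an (undirected) edge, an arc, or a mixed cycle; edge- and arc-components are not counted as cycles. A real spanning elementary subgraph of $M$ is a subgraph that is elementary, contains all vertices of $M$, and all of whose mixed cycles are real. *)

(* Defs.v *)
From mathcomp Require Import all_boot all_order all_algebra.

Set Implicit Arguments.
Unset Strict Implicit.
Unset Printing Implicit Defensive.

Import Order.TTheory GRing.Theory Num.Theory.
Local Open Scope ring_scope.

Record simple_graph (n : nat) := SimpleGraph {
  adj : rel 'I_n;
  adj_sym : symmetric adj;
  adj_irr : irreflexive adj }.

(* An arc (u, v) is an edge uv of the underlying graph, oriented from u to v;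
   an edge carries at most one orientation. *)
Record mixed_graph (n : nat) := MixedGraph {
  underlying : simple_graph n;
  is_arc : rel 'I_n;
  is_arc_adj : forall u v, is_arc u v -> adj underlying u v;
  is_arc_asym : forall u v, is_arc u v -> ~~ is_arc v u }.

Definition is_edge n (M : mixed_graph n) (u v : 'I_n) : bool :=
  [&& adj (underlying M) u v, ~~ is_arc M u v & ~~ is_arc M v u].

Definition degree n (M : mixed_graph n) (u : 'I_n) : nat :=
  #|[set v | adj (underlying M) u v]|.

(* The field of complex numbers may be any numClosedFieldType (R[i], algC...).
   The denominator is nonzero whenever the entry is, since d_k, d_l > 0 for
   adjacent vertices. *)
Definition hermitian_randic (C : numClosedFieldType) n (M : mixed_graph n) :
    'M[C]_n :=
  \matrix_(k, l)
    if is_edge M k l then 1 / sqrtC ((degree M k)%:R * (degree M l)%:R)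
    else if is_arc M k l then
      'i / sqrtC ((degree M k)%:R * (degree M l)%:R)
    else if is_arc M l k then
      - ('i / sqrtC ((degree M k)%:R * (degree M l)%:R))
    else 0.

(* A subgraph is a vertex set and a set of edges of the underlying graph, seen
   as unordered pairs; a retained edge keeps its status (undirected edge or arc)
   in M, so the orientation need not be recorded again. *)
Definition subgraph (n : nat) : Type := ({set 'I_n} * {set {set 'I_n}})%type.

Definition underlying_edges n (M : mixed_graph n) : {set {set 'I_n}} :=
  [set e | [exists u, exists v,
     adj (underlying M) u v && (e == [set u; v])]].

Definition is_subgraph n (M : mixed_graph n) (H : subgraph n) : bool :=
  (H.2 \subset underlying_edges M) && (cover H.2 \subset H.1).

Definition sub_adj n (H : subgraph n) : rel 'I_n :=
  fun u v => [set u; v] \in H.2.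

Definition components n (H : subgraph n) : {set subgraph n} :=
  [set (K, [set e in H.2 | e \subset K])
     | K : {set 'I_n} in equivalence_partition (connect (sub_adj H)) H.1].

Definition is_edge_graph n (M : mixed_graph n) (S : subgraph n) : bool :=
  [exists u, exists v,
     is_edge M u v && (S == ([set u; v], [set [set u; v]]))].

Definition is_arc_graph n (M : mixed_graph n) (S : subgraph n) : bool :=
  [exists u, exists v,
     is_arc M u v && (S == ([set u; v], [set [set u; v]]))].

(* A cycle v_1 v_2 ... v_l v_1 with a starting point and a direction is the
   sequence [:: v_1; ...; v_l]; [next c] is the cyclic successor. *)
Definition directed_cycle n (M : mixed_graph n) (c : seq 'I_n) : bool :=
  [&& (3 <= size c)%N, uniq c & cycle (adj (underlying M)) c].

Definition cycle_graph n (c : seq 'I_n) : subgraph n :=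
  ([set x in c], [set [set x; next c x] | x in c]).

Definition traverses n (M : mixed_graph n) (c : seq 'I_n) (S : subgraph n) :
    bool :=
  directed_cycle M c && (S == cycle_graph c).

Definition cycle_value (C : numClosedFieldType) n (M : mixed_graph n)
    (c : seq 'I_n) : C :=
  \prod_(x <- c) hermitian_randic C M x (next c x).

Definition is_mixed_cycle n (M : mixed_graph n) (S : subgraph n) : bool :=
  [exists c : #|S.1|.-tuple 'I_n, traverses M c S].

(* Changing the starting point preserves the value and reversing the direction
   conjugates it, so the choice of traversal in the next two definitions is
   immaterial. *)
Definition is_real_cycle (C : numClosedFieldType) n (M : mixed_graph n)
    (S : subgraph n) : bool :=
  [exists c : #|S.1|.-tuple 'I_n,
     traverses M c S && (cycle_value C M c \is Num.real)].

Definition is_negative_cycle (C : numClosedFieldType) n (M : mixed_graph n)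
    (S : subgraph n) : bool :=
  [exists c : #|S.1|.-tuple 'I_n,
     traverses M c S &&
     (cycle_value C M c == - \prod_(v in S.1) (1 / (degree M v)%:R))].

Definition is_elementary n (M : mixed_graph n) (H : subgraph n) : bool :=
  [forall S in components H,
     [|| is_edge_graph M S, is_arc_graph M S | is_mixed_cycle M S]].

Definition real_spanning_elementary (C : numClosedFieldType) n
    (M : mixed_graph n) (H : subgraph n) : bool :=
  [&& is_subgraph M H, H.1 == [set: 'I_n], is_elementary M H &
      [forall S in components H,
         is_mixed_cycle M S ==> is_real_cycle C M S]].

Definition sub_rank n (H : subgraph n) : nat := (n - #|components H|)%N.

Definition num_negative_cycles (C : numClosedFieldType) n (M : mixed_graph n)
    (H : subgraph n) : nat :=
  #|[set S in components H | is_negative_cycle C M S]|.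

Definition num_cycles n (M : mixed_graph n) (H : subgraph n) : nat :=
  #|[set S in components H | is_mixed_cycle M S]|.

Definition weight (C : numClosedFieldType) n (M : mixed_graph n)
    (H : subgraph n) : C :=
  \prod_(v in H.1) (1 / (degree M v)%:R).

(* Main.v *)
Require Import Defs.
From mathcomp Require Import all_boot all_order all_fingroup all_algebra.

Set Implicit Arguments.
Unset Strict Implicit.
Unset Printing Implicit Defensive.

Import Order.TTheory GRing.Theory Num.Theory.
Local Open Scope ring_scope.

(* In the Leibniz expansion, a permutation s contributes a nonzero term only if
   every {x, s x} is an edge, and then these edges form a spanning elementary
   subgraph whose components are the orbits of s. The permutations with the same
   edges as s are obtained from s by reversing a set of orbits of length at
   least 3; they have the sign of s, and reversing an orbit conjugates its value
   v. Summing over them thus yields a product with a factor v + v^* per long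
   orbit, which is +-2 times the weight of a real cycle and 0 for a non-real
   one. *)

(** * Permutations, their edge sets and their orbits *)

Definition perm_edges (T : finType) (s : {perm T}) : {set {set T}} :=
  [set [set x; s x] | x : T].

(* [B] is meant to be a set of orbits of [s]; other members are ignored. *)
Definition reverse_on (T : finType) (s : {perm T}) (B : {set {set T}}) (x : T) :
    T :=
  if porbit s x \in B then (s^-1)%g x else s x.

Section PermEdges.
Variable T : finType.
Implicit Types (s t : {perm T}) (x y u v : T) (K : {set T}) (B : {set {set T}}).

Lemma set2_inj x y u v :
  [set x; y] = [set u; v] -> (x = u /\ y = v) \/ (x = v /\ y = u).
Proof.
move=> e.
have := set21 x y; rewrite {1}e => /set2P[] xE.
  left; split=> //; have := set22 x y; rewrite {1}e => /set2P[] yE //.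
  have := set22 u v; rewrite -e xE yE => /set2P[] -> //.
right; split=> //; have := set22 x y; rewrite {1}e => /set2P[] yE //.
by have := set21 u v; rewrite -e xE yE => /set2P[] ->.
Qed.

Lemma mem_perm_edges s x y :
  ([set x; y] \in perm_edges s) = (y == s x) || (x == s y).
Proof.
apply/imsetP/orP => [[z _ /set2_inj[[-> ->]|[-> ->]]]|[/eqP->|/eqP->]].
- by left.
- by right.
- by exists x.
- by exists y => //; rewrite setUC.
Qed.

Lemma mem_porbit1 s x : s x \in porbit s x.
Proof. by have := mem_porbit s 1 x; rewrite expg1. Qed.

Lemma porbit1 s x : porbit s (s x) = porbit s x.
Proof. by apply/eqP; rewrite eq_porbit_mem mem_porbit1. Qed.

Lemma porbit1V s x : porbit s ((s^-1)%g x) = porbit s x.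
Proof. by rewrite -porbit1 permKV. Qed.

Lemma porbits_mem s K x : K \in porbits s -> (x \in K) = (porbit s x == K).
Proof. by case/imsetP=> y _ ->; rewrite eq_porbit_mem. Qed.

Lemma mem_porbits s x : porbit s x \in porbits s.
Proof. exact: imset_f. Qed.

Lemma porbits_stable s K x : K \in porbits s -> (s x \in K) = (x \in K).
Proof. by move=> sK; rewrite !(porbits_mem _ sK) porbit1. Qed.

(** An edge at [x] leads to [s x] or to a preimage of [x], and both stay in the orbit. Hence the
    edge set alone determines the orbits, although it forgets the direction of [s]. *)
Lemma connect_porbit s (e : rel T) :
    (forall x y, e x y = ([set x; y] \in perm_edges s)) ->
  forall x, [set y | connect e x y] = porbit s x.
Proof.
move=> eE x; apply/setP=> y; rewrite inE; apply/idP/idP.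
  case/connectP=> p + ->; elim: p x => [|z p IHp] x /=; first by rewrite porbit_id.
  rewrite eE mem_perm_edges => /andP[/orP[/eqP->|/eqP->] /IHp].
    by rewrite porbit1.
  by rewrite porbit1.
case/porbitP=> i ->; rewrite permX; elim: i => [|i IHi] //=.
apply: connect_trans IHi (connect1 _).
by rewrite eE mem_perm_edges eqxx.
Qed.

Lemma card_porbit_gt2 s x : (2 < #|porbit s x|)%N = (s (s x) != x).
Proof.
have := iter_porbit s x; have := uniq_traject_porbit s x.
have := card_porbit_neq0 s x.
(* Orbits of length 1 and 2 close up by the second step; in a longer one the first three iterates
   are distinct. *)
case: #|porbit s x| => [|[|[|m]]] //= _; first by move=> _ e; rewrite !e eqxx.
  by move=> _ ->; rewrite eqxx.
by rewrite !inE !negb_or => /andP[/and3P[_ ssx _] _] _; rewrite eq_sym.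
Qed.

Lemma perm_edges_eq s t :
  perm_edges s = perm_edges t -> forall x, s x = t x \/ t (s x) = x.
Proof.
move=> e x; have: [set x; s x] \in perm_edges t by rewrite -e; apply: imset_f.
by rewrite mem_perm_edges => /orP[] /eqP; [left | right].
Qed.

(* If two injections of [K] trace the same edges, then the points where they
   agree are stable, so they agree along a whole orbit or nowhere on it. *)
Lemma agree_stable (K : {set T}) (f g : T -> T) x :
    {in K, forall y, f y \in K} -> {in K, forall y, g y \in K} ->
    {in K &, injective f} -> {in K &, injective g} ->
    [set [set y; f y] | y in K] = [set [set y; g y] | y in K] ->
  x \in K -> f x = g x -> f (g x) = g (g x).
Proof.
move=> fK gK fI gI e xK fx.
have gxK := gK _ xK; have ggxK := gK _ gxK.
have: [set g x; f (g x)] \in [set [set y; g y] | y in K].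
  by rewrite -e; apply: imset_f.
case/imsetP=> y yK /set2_inj[[-> //]|[/(gI _ _ xK yK) <- fgx]].
(* Here [f (g x) = x]. Locating this edge of [g] among those of [f] either settles the claim or
   gives [g (g x) = x] too. *)
have: [set g x; g (g x)] \in [set [set y; f y] | y in K].
  by rewrite e; apply: imset_f.
case/imsetP=> z zK /set2_inj[[-> //]|[]].
rewrite -fx => /(fI _ _ xK zK) <- e2.
by rewrite fx fgx -[in g x]fx e2.
Qed.

(** Agreement at one point of [K] spreads along the orbit by [agree_stable]. So if [f] differs from
    [s] somewhere, it differs everywhere, and each edge at [y] must be the one by which [s] enters
    [y]. [f] is a mere function on [K] because it will be the successor map of a cycle. *)
Lemma orbit_orientation s K (f : T -> T) :
    K \in porbits s -> {in K, forall y, f y \in K} -> {in K &, injective f} ->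
    [set [set y; f y] | y in K] = [set [set y; s y] | y in K] ->
  {in K, f =1 s} \/ {in K, forall x, s (f x) = x}.
Proof.
move=> sK fK fI e.
have [/forall_inP h|/forall_inPn[x xK nfx]] :=
  boolP [forall (x | x \in K), f x == s x]; [by left=> x /h/eqP | right].
move=> y yK; have: [set y; f y] \in [set [set y; s y] | y in K].
  by rewrite -e; apply: imset_f.
case/imsetP=> z zK /set2_inj[[<- fy]|[-> ->]//].
case/negP: nfx; move: xK; rewrite (porbits_mem _ sK) => /eqP xK.
have: x \in porbit s y.
  by rewrite -eq_porbit_mem xK eq_sym -(porbits_mem _ sK).
case/porbitP=> i ->; rewrite permX.
have IH j : iter j s y \in K /\ f (iter j s y) = s (iter j s y).
  elim: j => [|j [IHK IHj]] //=; split; first by rewrite porbits_stable.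
  apply: (@agree_stable K f s _) => //; last exact: in2W (perm_inj).
  by move=> w; rewrite porbits_stable.
by case: (IH i) => _ /eqP.
Qed.

Lemma perm_edges_setT s : [set [set y; s y] | y in [set: T]] = perm_edges s.
Proof. by apply/setP=> e; apply/imsetP/imsetP=> -[x _ ->]; exists x. Qed.

Lemma agree_orbit s t x y :
    perm_edges t = perm_edges s -> y \in porbit s x -> t x = s x -> t y = s y.
Proof.
move=> e /porbitP[i ->] tx; rewrite permX.
elim: i => [|i IHi] //=.
apply: (@agree_stable setT t s _); rewrite ?inE //; last by rewrite !perm_edges_setT.
- exact: in2W perm_inj.
- exact: in2W perm_inj.
Qed.

Lemma prod_porbits (R : Type) (idx : R) (op : Monoid.com_law idx) s (F : T -> R) :
  \big[op/idx]_x F x = \big[op/idx]_(K in porbits s) \big[op/idx]_(x in K) F x.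
Proof.
rewrite (partition_big (porbit s) (mem (porbits s))) /=; last first.
  by move=> x _; apply: mem_porbits.
by apply: eq_bigr => K sK; apply: eq_bigl => x; rewrite (porbits_mem _ sK).
Qed.

Lemma perm_edges_porbits s t :
  perm_edges t = perm_edges s -> porbits t = porbits s.
Proof.
move=> e; apply: eq_imset => x.
rewrite -(@connect_porbit t (fun x y => [set x; y] \in perm_edges t)) //.
by apply: connect_porbit => u v; rewrite e.
Qed.

(** The sign depends only on [#|T|] and the number of orbits. *)
Lemma perm_edges_odd s t : perm_edges t = perm_edges s -> t = s :> bool.
Proof. by move=> e; rewrite /odd_perm (perm_edges_porbits e). Qed.

Lemma porbit_reverse_on s B x : porbit s (reverse_on s B x) = porbit s x.
Proof. by rewrite /reverse_on; case: ifP; rewrite ?porbit1 ?porbit1V. Qed.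

(** Points with a common image lie in one orbit of [s], hence are moved in the same direction. *)
Lemma reverse_on_inj s B : injective (reverse_on s B).
Proof.
move=> x y e; have o : porbit s x = porbit s y.
  by rewrite -(porbit_reverse_on s B x) e porbit_reverse_on.
by move: e; rewrite /reverse_on o; case: ifP => _ /perm_inj.
Qed.

Lemma perm_edges_reverse_on s B :
  perm_edges (perm (@reverse_on_inj s B)) = perm_edges s.
Proof.
apply/setP=> e; apply/imsetP/imsetP=> -[x _ ->].
  rewrite permE /reverse_on; case: ifP => _; last by exists x.
  by exists ((s^-1)%g x); rewrite // permKV setUC.
have [xB|xB] := boolP (porbit s x \in B).
  by exists (s x); rewrite // permE /reverse_on porbit1 xB permK setUC.
by exists x; rewrite // permE /reverse_on (negPf xB).
Qed.

End PermEdges.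

(** * Permutations with given edges correspond to sets of long orbits *)

Section ReversedOrbits.
Variable T : finType.
Implicit Types (s t : {perm T}) (B : {set {set T}}).

Definition reversed_orbits s t : {set {set T}} :=
  [set K in porbits s | [exists (x | x \in K), t x != s x]].

Definition long_orbits s : {set {set T}} := [set K in porbits s | (2 < #|K|)%N].

Lemma reversed_orbitsK s t :
  perm_edges t = perm_edges s -> perm (@reverse_on_inj T s (reversed_orbits s t)) = t.
Proof.
move=> e; apply/permP=> x; rewrite permE /reverse_on inE mem_porbits /=.
case: ifPn => [/exists_inP[y yx nty]|/exists_inPn h].
  case: (perm_edges_eq e x) => [tx|]; last by move=> {1}<-; rewrite permK.
  by rewrite (agree_orbit e yx tx) eqxx in nty.
by have := h x (porbit_id s x); rewrite negbK => /eqP.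
Qed.

(** Reversing an orbit of length at most 2 changes nothing, so [B] can be read off exactly when its
    members are long orbits. Together with [reversed_orbitsK] this is the bijection needed for
    reindexing. *)
Lemma reverse_onK s B :
  (reversed_orbits s (perm (@reverse_on_inj T s B)) == B) = (B \subset long_orbits s).
Proof.
have longE K x : K \in porbits s -> x \in K ->
    (K \in long_orbits s) = ((s^-1)%g x != s x).
  move=> sK; rewrite (porbits_mem _ sK) => /eqP <-.
  rewrite inE mem_porbits card_porbit_gt2 -[in RHS](inj_eq (@perm_inj _ s)).
  by rewrite permKV eq_sym.
apply/eqP/subsetP=> [<- K|sub].
  rewrite [in X in X -> _]inE => /andP[sK /exists_inP[x xK]].
  rewrite (longE _ x) // permE /reverse_on; case: ifP => //.
  by rewrite eqxx.
apply/setP=> K; rewrite inE; apply/andP/idP => [[sK /exists_inP[x xK]]|KB].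
  rewrite permE /reverse_on; move: xK; rewrite (porbits_mem _ sK) => /eqP ->.
  by case: ifP => //; rewrite eqxx.
have lK := sub _ KB; have sK : K \in porbits s by move: lK; rewrite inE => /andP[].
split=> //; case/imsetP: (sK) => x _ KE.
have xK : x \in K by rewrite KE porbit_id.
apply/exists_inP; exists x => //; rewrite permE /reverse_on -KE KB.
by rewrite -(longE K).
Qed.

End ReversedOrbits.

(** * Leibniz terms of a Hermitian matrix, grouped by edge set *)

Section HermitianDeterminant.
Variables (C : numClosedFieldType) (n : nat) (A : 'M[C]_n).
Hypothesis hermA : forall x y, A y x = (A x y)^*.

Definition orbit_value (s : {perm 'I_n}) (K : {set 'I_n}) : C :=
  \prod_(x in K) A x (s x).

(** Substituting [s x] for [x], which permutes [K], turns the factors into [A (s x) x]. *)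
Lemma orbit_valueV s K : K \in porbits s ->
  \prod_(x in K) A x ((s^-1)%g x) = (orbit_value s K)^*.
Proof.
move=> sK; rewrite rmorph_prod (reindex_inj (@perm_inj _ s)) /=.
rewrite (eq_bigl _ _ (fun x => porbits_stable x sK)).
by apply: eq_bigr => x _; rewrite permK hermA.
Qed.

Lemma prod_reverse_on s (B : {set {set 'I_n}}) :
  \prod_x A x (reverse_on s B x) =
  \prod_(K in porbits s) if K \in B then (orbit_value s K)^* else orbit_value s K.
Proof.
rewrite (prod_porbits _ s); apply: eq_bigr => K sK.
transitivity (\prod_(x in K) A x (if K \in B then (s^-1)%g x else s x)).
  by apply: eq_bigr => x; rewrite (porbits_mem _ sK) /reverse_on => /eqP ->.
by case: ifP => _ //; apply: orbit_valueV.
Qed.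

(* Expanding the product over the orbits chooses, for each long orbit, one of
   its two directions. *)
Lemma sum_same_edges (s : {perm 'I_n}) :
  \sum_(t : {perm 'I_n} | perm_edges t == perm_edges s)
     (-1) ^+ t * \prod_x A x (t x) =
  (-1) ^+ s * \prod_(K in porbits s)
     (orbit_value s K + if (2 < #|K|)%N then (orbit_value s K)^* else 0).
Proof.
rewrite (reindex_onto (fun B => perm (@reverse_on_inj _ s B))
                      (reversed_orbits s)) /=; last first.
  by move=> t /eqP; apply: reversed_orbitsK.
transitivity (\sum_(B : {set {set 'I_n}} | B \subset long_orbits s)
    (-1) ^+ s * \prod_(K in porbits s)
      if K \in B then (orbit_value s K)^* else orbit_value s K).
  apply: eq_big => [B|B _]; first by rewrite perm_edges_reverse_on eqxx reverse_onK.
  rewrite (perm_edges_odd (perm_edges_reverse_on s B)) -prod_reverse_on.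
  by congr (_ * _); apply: eq_bigr => x _; rewrite permE.
rewrite -big_distrr /=; congr (_ * _).
(* [F] and [G] extend the two summands to all sets: the factor of a non-orbit is 0 + 1, and [F]
   vanishes off the long orbits. This kills every term of the expansion whose [B] is not a set of
   long orbits. *)
pose F K := if K \in long_orbits s then (orbit_value s K)^* else 0.
pose G K := if K \in porbits s then orbit_value s K else 1.
transitivity (\prod_(K : {set 'I_n}) (F K + G K)); last first.
  rewrite [RHS]big_mkcond; apply: eq_bigr => K _; rewrite /F /G inE addrC.
  by case: ifP => //= _; rewrite addr0.
rewrite bigA_distr big_mkcond; apply: eq_bigr => B _.
case: ifPn => [/subsetP sub|/subsetPn[K KB nK]]; last first.
  by rewrite (bigD1 K) //= KB /F (negPf nK) mul0r.
rewrite big_mkcond; apply: eq_bigr => K _; rewrite /F /G.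
case KB: (K \in B) => //; rewrite (sub _ KB).
by have := sub _ KB; rewrite inE => /andP[->].
Qed.

End HermitianDeterminant.

(** * Orbit values of the Hermitian-Randić matrix *)

Section MixedGraphs.
Variables (C : numClosedFieldType) (n : nat) (M : mixed_graph n).
Local Notation adjM := (adj (underlying M)).
Local Notation A := (hermitian_randic C M).
Implicit Types (s : {perm 'I_n}) (x y : 'I_n) (K : {set 'I_n}).

Definition phase x y : C :=
  if is_edge M x y then 1 else if is_arc M x y then 'i
  else if is_arc M y x then - 'i else 0.

Definition set_weight K : C := \prod_(v in K) (1 / (degree M v)%:R).

Lemma hermitian_randicE x y :
  A x y = phase x y * ((sqrtC (degree M x)%:R)^-1 * (sqrtC (degree M y)%:R)^-1).
Proof.
rewrite mxE /phase sqrtCM ?nnegrE ?ler0n // invfM.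
by do 3?[case: ifP => _ //]; rewrite ?mulNr ?mul0r.
Qed.

Lemma is_edge_sym x y : is_edge M x y = is_edge M y x.
Proof. by rewrite /is_edge adj_sym [~~ _ && _]andbC. Qed.

Lemma phaseJ x y : phase y x = (phase x y)^*.
Proof.
rewrite /phase is_edge_sym; case: ifP => _; first by rewrite rmorph1.
have := @is_arc_asym _ M x y.
case: (is_arc M x y) => [/(_ isT)/negPf->|_]; first by rewrite conjCi.
by case: ifP => _; rewrite ?rmorphN /= ?conjCi ?opprK ?rmorph0.
Qed.

Lemma hermitian_randicJ x y : A y x = (A x y)^*.
Proof.
rewrite !hermitian_randicE phaseJ !rmorphM /= !fmorphV /=.
by rewrite ![(sqrtC _)^*]geC0_conj ?sqrtC_ge0 ?ler0n // [X in _ * X]mulrC.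
Qed.

Lemma phase_nadj x y : ~~ adjM x y -> phase x y = 0.
Proof.
move=> nxy; rewrite /phase /is_edge (negPf nxy) /=.
case: ifP => [/is_arc_adj|_]; first by rewrite (negPf nxy).
by case: ifP => [/is_arc_adj|//]; rewrite adj_sym (negPf nxy).
Qed.

Definition fourth_roots : seq C := [:: 1; -1; 'i; - 'i].

(** Factor [e ^+ 4 - 1] as a product of two differences of squares. The power form makes closure
    under products immediate. *)
Lemma fourth_rootsP e : reflect (e ^+ 4 = 1) (e \in fourth_roots).
Proof.
have i4 : 'i ^+ 4 = 1 :> C by rewrite (exprM _ 2 2) sqrCi sqrrN expr1n.
apply: (iffP idP) => [|e4].
  rewrite !inE => /or4P[] /eqP ->; rewrite ?expr1n //.
  - by rewrite (exprM _ 2 2) sqrrN !expr1n.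
  - by rewrite (exprM _ 2 2) sqrrN -exprM.
have : (e ^+ 2 - 1) * (e ^+ 2 - 'i ^+ 2) == 0.
  by rewrite sqrCi opprK -subr_sqr -exprM e4 expr1n subrr.
rewrite -(expr1n C 2) mulf_eq0 !subr_eq0 !eqf_sqr !inE.
by case/orP=> /orP[] -> //; rewrite ?orbT.
Qed.

Lemma phase_root x y : adjM x y -> phase x y \in fourth_roots.
Proof.
move=> xy; rewrite /phase /is_edge xy !inE /=.
case: (is_arc M x y) => /=; first by rewrite eqxx !orbT.
by case: (is_arc M y x) => /=; rewrite eqxx ?orbT.
Qed.

Lemma degree_gt0 x y : adjM x y -> (0 < degree M x)%N.
Proof. by move=> xy; apply/card_gt0P; exists y; rewrite inE. Qed.

Variable s : {perm 'I_n}.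
Hypothesis adj_s : forall x, adjM x (s x).

Lemma set_weight_gt0 K : 0 < set_weight K.
Proof.
apply: prodr_gt0 => x _; rewrite divr_gt0 ?ltr01 // ltr0n.
exact: degree_gt0 (adj_s x).
Qed.

(** Each vertex of [K] contributes the inverse root of its degree twice, once as source and once as
    target. *)
Lemma orbit_valueE K : K \in porbits s ->
  orbit_value A s K = (\prod_(x in K) phase x (s x)) * set_weight K.
Proof.
move=> sK; rewrite /orbit_value (eq_bigr _ (fun x _ => hermitian_randicE x (s x))).
rewrite big_split big_split /=; congr (_ * _).
rewrite [X in _ * X](_ : _ = \prod_(x in K) (sqrtC (degree M x)%:R)^-1).
  rewrite -big_split /=; apply: eq_bigr => x _.
  by rewrite -invfM -expr2 sqrtCK mul1r.
rewrite [RHS](reindex_inj (@perm_inj _ s)).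
by apply: eq_bigl => x; rewrite porbits_stable.
Qed.

Lemma orbit_phase_root K : \prod_(x in K) phase x (s x) \in fourth_roots.
Proof.
apply/fourth_rootsP; rewrite -prodrXl big1 // => x _.
exact/fourth_rootsP/phase_root.
Qed.

Lemma perm_adj_neq x : s x != x.
Proof. by apply: contraTneq (adj_s x) => ->; rewrite adj_irr. Qed.

Lemma orbit_short K : K \in porbits s -> (#|K| <= 2)%N ->
  exists2 x, K = [set x; s x] & s (s x) = x.
Proof.
move=> /imsetP[x _ ->]; rewrite leqNgt card_porbit_gt2 negbK => /eqP ssx.
exists x => //; apply/setP=> y; rewrite !inE; apply/idP/orP => [/porbitP[i ->]|].
  rewrite permX; elim: i => [|i [/eqP IHi|/eqP IHi]] /=; first by left.
    by right; rewrite IHi.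
  by left; rewrite IHi ssx.
by case=> /eqP ->; rewrite ?porbit_id ?mem_porbit1.
Qed.

(** The orbit is one edge run back and forth, as [s] has no fixed point; its two phases are
    conjugate of modulus 1. *)
Lemma orbit_value_short K : K \in porbits s -> (#|K| <= 2)%N ->
  orbit_value A s K = set_weight K.
Proof.
move=> sK /(orbit_short sK)[x KE ssx]; rewrite orbit_valueE //.
rewrite [X in X * _](_ : _ = 1) ?mul1r // KE big_setU1 ?inE 1?eq_sym ?perm_adj_neq //=.
rewrite big_set1 ssx (phaseJ x).
have := phase_root (adj_s x); rewrite !inE.
by case/or4P=> /eqP ->; rewrite ?rmorphN /= ?conjC1 ?conjCi ?mulrNN ?mulrN ?opprK ?mulr1
  // ?mulNr -?expr2 ?sqrCi ?opprK.
Qed.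

Lemma realCi : ('i : C) \isn't Num.real.
Proof. by rewrite CrealE conjCi eq_sym -addr_eq0 -mulr2n mulrn_eq0 /= neq0Ci. Qed.

(** The value is [e * W] with [W] positive and [e] a fourth root of unity. For [e] equal to 1 or -1
    it is real and gets doubled; for ['i] and [- 'i] it is purely imaginary and cancels. Since [W]
    is nonzero, the boolean exponent separates the two real cases. *)
Lemma orbit_value_addJ K : K \in porbits s ->
  orbit_value A s K + (orbit_value A s K)^* =
  if orbit_value A s K \is Num.real
  then 2 * (-1) ^+ (orbit_value A s K == - set_weight K) * set_weight K else 0.
Proof.
move=> sK; have W0 := set_weight_gt0 K; have Wr := gtr0_real W0.
have Wn0 : set_weight K != 0 by rewrite gt_eqF.
rewrite orbit_valueE //; have := orbit_phase_root K.
set e := \prod_(x in K) _; set W := set_weight K in W0 Wr Wn0 *; rewrite !inE.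
case/or4P=> /eqP ->.
- by rewrite mul1r Wr conj_Creal // -addr_eq0 -mulr2n mulrn_eq0 (negPf Wn0) /=
    mulr1 mulr_natl.
- rewrite mulN1r realN Wr rmorphN /= conj_Creal // eqxx expr1.
  by rewrite -mulrA mulN1r mulr_natl mulr2n.
- rewrite rmorphM /= conjCi (conj_Creal Wr) mulNr subrr ifF //.
  by rewrite CrealE rmorphM /= conjCi (conj_Creal Wr) (inj_eq (mulIf Wn0)) -conjCi -CrealE
    (negPf realCi).
- rewrite rmorphM rmorphN /= conjCi opprK (conj_Creal Wr) mulNr addrC subrr ifF //.
  by rewrite realN CrealE rmorphM /= conjCi (conj_Creal Wr) (inj_eq (mulIf Wn0))
    -conjCi -CrealE (negPf realCi).
Qed.

End MixedGraphs.

(** * The spanning subgraph traced by a permutation *)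

Definition perm_graph n (s : {perm 'I_n}) : subgraph n :=
  ([set: 'I_n], perm_edges s).

Definition orbit_graph n (s : {perm 'I_n}) (K : {set 'I_n}) : subgraph n :=
  (K, [set [set x; s x] | x in K]).

Section PermGraph.
Variables (n : nat) (s : {perm 'I_n}).

Lemma components_perm_graph :
  components (perm_graph s) = [set orbit_graph s K | K in porbits s].
Proof.
have partE : equivalence_partition (connect (sub_adj (perm_graph s))) setT =
             porbits s.
  apply/setP=> K; apply/imsetP/imsetP=> -[x _ ->]; exists x => //;
    rewrite -(@connect_porbit _ s (sub_adj (perm_graph s))) //;
    by apply/setP=> y; rewrite !inE.
rewrite /components /= partE; apply: eq_in_imset => K sK; congr (_, _).
apply/setP=> e; rewrite inE; apply/andP/imsetP => [[/imsetP[x _ ->]]|[x xK ->]].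
  by rewrite subUset !sub1set => /andP[xK _]; exists x.
split; first by apply/imsetP; exists x.
by rewrite subUset !sub1set porbits_stable // xK.
Qed.

Lemma orbit_graph_inj : injective (orbit_graph s).
Proof. by move=> K L []. Qed.

(** As a sum over orbits, the count turns powers with this exponent into products over orbits. *)
Lemma card_components_perm_graph (P : pred (subgraph n)) :
  #|[set S in components (perm_graph s) | P S]| =
  (\sum_(K in porbits s) P (orbit_graph s K))%N.
Proof.
rewrite components_perm_graph -sum1_card.
transitivity (\sum_(S in [set orbit_graph s K | K in porbits s]) P S)%N.
  rewrite (eq_bigl _ _ (in_set _)) /= big_mkcondr.
  by apply: eq_bigr => S _; case: (P S).
by rewrite big_imset //; apply: in2W orbit_graph_inj.
Qed.

End PermGraph.

Lemma mem_underlying_edges n (M : mixed_graph n) x y :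
  ([set x; y] \in underlying_edges M) = adj (underlying M) x y.
Proof.
rewrite inE; apply/existsP/idP => [[u /existsP[v /andP[uv /eqP]]]|xy].
  by case/set2_inj=> -[-> ->] //; rewrite adj_sym.
by exists x; apply/existsP; exists y; rewrite xy eqxx.
Qed.

(** * Long orbits as mixed cycles *)

Section Traversals.
Variables (C : numClosedFieldType) (n : nat) (M : mixed_graph n).
Variable s : {perm 'I_n}.
Local Notation adjM := (adj (underlying M)).
Local Notation A := (hermitian_randic C M).
Hypothesis adj_s : forall x, adjM x (s x).

(** On [K], [next c] is an injection with the same edges as [s], so by [orbit_orientation] it
    follows [s] or its inverse; the inverse gives the conjugate value. *)
Lemma traverses_orbit K (c : seq 'I_n) : K \in porbits s ->
    traverses M c (orbit_graph s K) ->
  (2 < #|K|)%N /\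
  (cycle_value C M c = orbit_value A s K \/
   cycle_value C M c = (orbit_value A s K)^*).
Proof.
move=> sK /andP[/and3P[c3 Uc _] /eqP[KE eE]].
have mK x : (x \in K) = (x \in c) by rewrite KE inE.
split; first by rewrite KE cardsE (card_uniqP Uc).
have eE' : [set [set x; next c x] | x in K] = [set [set x; s x] | x in K].
  by rewrite eE; apply/setP=> e; apply/imsetP/imsetP => -[x xc ->]; exists x;
    rewrite // ?mK // -mK.
have nK : {in K, forall x, next c x \in K} by move=> x; rewrite !mK mem_next.
have nI : {in K &, injective (next c)}.
  exact: in2W (can_inj (prev_next Uc)).
rewrite /cycle_value big_uniq //= -(eq_bigl _ _ mK).
case: (orbit_orientation sK nK nI eE') => h; [left | right].
  by apply: eq_bigr => x xK; rewrite h.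
rewrite -orbit_valueV //; last exact: hermitian_randicJ.
apply: eq_bigr => x xK; congr (A x _); apply: (@perm_inj _ s).
by rewrite permKV h.
Qed.

(** Serves all three cycle predicates at once: conjugation invariance of [P] makes the direction
    irrelevant, and the trajectory of [s] supplies a traversal. *)
Lemma exists_traversal K (P : pred C) : K \in porbits s ->
    (forall v, P v^* = P v) ->
  [exists c : #|K|.-tuple 'I_n,
     traverses M c (orbit_graph s K) && P (cycle_value C M c)] =
  (2 < #|K|)%N && P (orbit_value A s K).
Proof.
move=> sK PJ; apply/existsP/andP => [[c /andP[/(traverses_orbit sK)[K3 vE] Pc]]|].
  by split=> //; case: vE Pc => ->; rewrite ?PJ.
case=> K3 PK; case/imsetP: (sK) => x _ KE.
have sz : size (traject s x #|K|) == #|K| by rewrite size_traject.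
have Uc : uniq (traject s x #|K|) by rewrite KE uniq_traject_porbit.
have mc : traject s x #|K| =i K by move=> y; rewrite KE porbit_traject.
have fc : fcycle s (traject s x #|K|).
  have := iter_porbit s x; rewrite -KE; case: #|K| => // k xE /=.
  (* The trajectory closes up because [s] returns to [x] after [#|K|] steps. *)
  have -> : rcons (traject s (s x) k) x = traject s (s x) k.+1.
    by rewrite trajectSr -iterSr xE.
  exact: fpath_traject.
have tr : traverses M (traject s x #|K|) (orbit_graph s K).
  rewrite /traverses /directed_cycle size_traject K3 Uc /=; apply/andP; split.
    apply: cycle_from_next => // y yc; rewrite (nextE fc) //; exact: adj_s.
  apply/eqP; congr (_, _); first by apply/setP=> y; rewrite inE mc.
  apply/setP=> e; apply/imsetP/imsetP => -[y yK ->]; exists y; rewrite ?mc // -?mc //.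
    by rewrite (nextE fc) ?mc.
  by rewrite (nextE fc).
exists (Tuple sz) => /=; rewrite tr /=.
by case: (traverses_orbit sK tr) => _ [] ->; rewrite ?PJ.
Qed.

Lemma is_mixed_cycle_orbit K : K \in porbits s ->
  is_mixed_cycle M (orbit_graph s K) = (2 < #|K|)%N.
Proof.
move=> sK; rewrite -[RHS]andbT -(exists_traversal (P := predT) sK) //.
by apply: eq_existsb => c; rewrite andbT.
Qed.

Lemma is_real_cycle_orbit K : K \in porbits s ->
  is_real_cycle C M (orbit_graph s K) =
  (2 < #|K|)%N && (orbit_value A s K \is Num.real).
Proof.
by move=> sK; apply: (exists_traversal (P := fun v => v \is Num.real) sK) => v; rewrite CrealJ.
Qed.

Lemma is_negative_cycle_orbit K : K \in porbits s ->
  is_negative_cycle C M (orbit_graph s K) =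
  (2 < #|K|)%N && (orbit_value A s K == - set_weight C M K).
Proof.
move=> sK; apply: (exists_traversal (P := pred1 (- set_weight C M K)) sK) => v /=.
rewrite -(can_eq (@conjCK C)) conjCK rmorphN /= conj_Creal //.
exact/gtr0_real/set_weight_gt0/adj_s.
Qed.

Lemma orbit_graph_short K : K \in porbits s -> (#|K| <= 2)%N ->
  is_edge_graph M (orbit_graph s K) || is_arc_graph M (orbit_graph s K).
Proof.
move=> sK /(orbit_short sK)[x KE ssx].
have gE : orbit_graph s K = ([set x; s x], [set [set x; s x]]).
  by rewrite /orbit_graph KE imsetU1 imset_set1 ssx [[set s x; x]]setUC setUid.
rewrite gE; have := adj_s x.
have [xs _|nxs] := boolP (is_arc M x (s x)).
  by apply/orP; right; apply/existsP; exists x; apply/existsP; exists (s x);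
    rewrite xs eqxx.
have [sx _|nsx xs] := boolP (is_arc M (s x) x).
  apply/orP; right; apply/existsP; exists (s x); apply/existsP; exists x.
  by rewrite sx setUC eqxx.
apply/orP; left; apply/existsP; exists x; apply/existsP; exists (s x).
by rewrite /is_edge xs nxs nsx eqxx.
Qed.

(** Since [s] moves along edges of [M], its graph is always spanning and elementary; only reality of
    the cycles remains to be tested. *)
Lemma real_spanning_perm_graph :
  real_spanning_elementary C M (perm_graph s) =
  [forall (K | K \in porbits s), (2 < #|K|)%N ==> (orbit_value A s K \is Num.real)].
Proof.
rewrite /real_spanning_elementary eqxx /=.
have -> : is_subgraph M (perm_graph s).
  rewrite /is_subgraph subsetT andbT; apply/subsetP=> e /imsetP[x _ ->].
  by rewrite mem_underlying_edges.
have -> /= : is_elementary M (perm_graph s).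
  apply/forall_inP=> S; rewrite components_perm_graph => /imsetP[K sK ->].
  have [K2|K3] := leqP #|K| 2; first by rewrite orbA orbit_graph_short.
  by rewrite is_mixed_cycle_orbit // K3 !orbT.
apply/forall_inP/forall_inP => [h K sK|h S].
  have := h (orbit_graph s K); rewrite components_perm_graph imset_f // => /(_ isT).
  rewrite is_mixed_cycle_orbit // is_real_cycle_orbit //.
  by case: (2 < #|K|)%N.
rewrite components_perm_graph => /imsetP[K sK ->].
rewrite is_mixed_cycle_orbit // is_real_cycle_orbit //.
by have := h K sK; case: (2 < #|K|)%N.
Qed.

Lemma sum_perm_graph :
  \sum_(t : {perm 'I_n} | perm_edges t == perm_edges s)
     (-1) ^+ t * \prod_x A x (t x) =
  if real_spanning_elementary C M (perm_graph s) then
    (-1) ^+ (sub_rank (perm_graph s) + num_negative_cycles C M (perm_graph s))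
    * 2 ^+ num_cycles M (perm_graph s) * weight C M (perm_graph s)
  else 0.
Proof.
rewrite sum_same_edges; last exact: hermitian_randicJ.
rewrite real_spanning_perm_graph.
case: ifPn => [/forall_inP real|/forall_inPn[K sK]]; last first.
  rewrite negb_imply => /andP[K3 nreal]; rewrite (bigD1 K) //= K3.
  by rewrite orbit_value_addJ // (negPf nreal) mul0r mulr0.
rewrite /num_negative_cycles /num_cycles !card_components_perm_graph.
rewrite exprD -!mulrA; congr (_ * _).
  (* The components are the orbits, so the rank has the parity of [s]. *)
  have -> : sub_rank (perm_graph s) = (#|'I_n| - #|porbits s|)%N.
    rewrite /sub_rank card_ord components_perm_graph card_imset //.
    exact: orbit_graph_inj.
  rewrite -[RHS]signr_odd oddB //.
  exact: leq_imset_card.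
(* Both powers and the weight become products over orbits, to be compared factor by factor. *)
rewrite -!prodrXr /weight /= [X in _ * (_ * X)](eq_bigl predT); last by move=> x; rewrite inE.
rewrite (prod_porbits _ s) -!big_split /=; apply: eq_bigr => K sK.
rewrite is_mixed_cycle_orbit // is_negative_cycle_orbit //.
have := real K sK; have [K2 _|K3 /= Kr] := leqP #|K| 2.
  by rewrite addr0 orbit_value_short // !mul1r.
by rewrite orbit_value_addJ // Kr [2 * _]mulrC -mulrA.
Qed.

End Traversals.

(** * Every spanning elementary subgraph comes from a permutation *)

Section Existence.
Variables (n : nat) (M : mixed_graph n).

(* A single edge uv is the degenerate cycle [:: u; v]. *)
Lemma elementary_component_cycle (S : subgraph n) :
    [|| is_edge_graph M S, is_arc_graph M S | is_mixed_cycle M S] ->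
  exists c : seq 'I_n, uniq c && (S == cycle_graph c).
Proof.
have edge u v : adj (underlying M) u v ->
  uniq [:: u; v] && (([set u; v], [set [set u; v]]) == cycle_graph [:: u; v]).
  move=> uv; have nuv : u != v by apply: contraTneq uv => ->; rewrite adj_irr.
  have cE : [set x in [:: u; v]] = [set u; v] by apply/setP=> x; rewrite !inE.
  rewrite /= inE nuv /=; apply/eqP; rewrite /cycle_graph cE; congr (_, _).
  rewrite (_ : [set _ | x in [:: u; v]] = [set [set x; next [:: u; v] x] | x in [set u; v]]).
    rewrite imsetU1 imset_set1 /= eqxx [v == u]eq_sym (negPf nuv) eqxx.
    by rewrite [[set v; u]]setUC setUid.
  by apply/setP=> e; apply/imsetP/imsetP => -[x xc ->]; exists x; move: xc; rewrite // !inE.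
case/or3P=> [/existsP[u /existsP[v /andP[/and3P[uv _ _] /eqP ->]]]
            |/existsP[u /existsP[v /andP[/is_arc_adj uv /eqP ->]]]
            |/existsP[c /andP[/and3P[_ Uc _] SE]]].
- by exists [:: u; v]; apply: edge.
- by exists [:: u; v]; apply: edge.
- by exists c; rewrite Uc.
Qed.

(** Choose a cycle through each component, degenerate for a single edge, and send each vertex to its
    successor there. *)
Lemma elementary_perm_graph (H : subgraph n) :
    is_subgraph M H -> H.1 = setT -> is_elementary M H ->
  exists2 s : {perm 'I_n}, H = perm_graph s & forall x, adj (underlying M) x (s x).
Proof.
case: H => V E /andP[/= subE _] VT /forall_inP elem; subst V.
pose e := sub_adj ([set: 'I_n], E).
have e_sym : connect_sym e.
  by apply: sym_connect_sym => u v; rewrite /e /sub_adj setUC.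
pose K x := [set y | connect e x y].
have KE x y : y \in K x -> K y = K x.
  rewrite inE => xy; apply/setP=> z; rewrite !inE.
  by rewrite (same_connect e_sym xy).
have Kx x : x \in K x by rewrite inE connect0.
have compK x : (K x, [set d in E | d \subset K x]) \in components ([set: 'I_n], E).
  apply/imsetP; exists (K x) => //.
  apply/imsetP; exists x => //; apply/setP=> y; by rewrite !inE.
(* The cycle is chosen per vertex set, not per vertex, so that all vertices of a component use the
   same direction. Sets that are not components get the dummy [[::]]. *)
pose is_comp_cycle (L : {set 'I_n}) (c : seq 'I_n) :=
  L \in [set K x | x : 'I_n] ->
  uniq c && ((L, [set d in E | d \subset L]) == cycle_graph c).
have [c cP] : exists c : {set 'I_n} -> seq 'I_n, forall L, is_comp_cycle L (c L).
  apply: (fin_all_exists (P := is_comp_cycle)) => L; rewrite /is_comp_cycle.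
  have [/imsetP[x _ ->]|nL] := boolP (L \in _).
    by have [c cP] := elementary_component_cycle (elem _ (compK x)); exists c.
  by exists [::].
have cK x : uniq (c (K x)) /\ (K x, [set d in E | d \subset K x]) = cycle_graph (c (K x)).
  by have /andP[? /eqP] := cP (K x) (imset_f _ (isT : x \in 'I_n)).
pose f x := next (c (K x)) x.
have mcK x y : (y \in c (K x)) = (y \in K x).
  by have [_ [cE _]] := cK x; rewrite [in RHS]cE inE.
have fK x : K (f x) = K x by apply: KE; rewrite -mcK mem_next mcK.
have f_inj : injective f.
  move=> x y xy; have Kxy : K x = K y by rewrite -fK xy fK.
  move: xy; rewrite /f Kxy; have [Uc _] := cK y.
  exact: (can_inj (prev_next Uc)).
have fE x : [set x; f x] \in E.
  have [_ [_ cE]] := cK x.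
  have : [set x; f x] \in [set d in E | d \subset K x].
    by rewrite cE; apply/imsetP; exists x => //; rewrite mcK.
  by rewrite inE => /andP[].
exists (perm f_inj); last first.
  by move=> x; rewrite -mem_underlying_edges permE (subsetP subE).
(* An edge of [E] joins connected vertices, so it lies in one component and hence on the cycle
   chosen for it. *)
congr (_, _); apply/setP=> d; apply/idP/imsetP => [dE|[x _ ->]]; last by rewrite permE.
have := subsetP subE _ dE; rewrite inE => /existsP[u /existsP[v /andP[_ /eqP dd]]].
have uv : connect e u v by apply: connect1; rewrite /e /sub_adj /= -dd.
have : d \in [set d in E | d \subset K u].
  by rewrite inE dE dd subUset !sub1set Kx inE.
have [_ [_ ->]] := cK u; case/imsetP=> x; rewrite mcK => xK ->.
by exists x => //; rewrite permE /f (KE _ _ xK).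
Qed.

End Existence.

(** * The Leibniz expansion grouped by subgraphs *)

Theorem theorem2p1 (C : numClosedFieldType) (n : nat) (M : mixed_graph n) :
  \det (hermitian_randic C M) =
  \sum_(H : subgraph n | real_spanning_elementary C M H)
     (-1) ^+ (sub_rank H + num_negative_cycles C M H)
     * 2 ^+ num_cycles M H * weight C M H.
Proof.
rewrite /determinant.
rewrite (bigID (fun s : {perm 'I_n} => [forall x, adj (underlying M) x (s x)])) /=.
(* A permutation sending some [x] to a non-neighbour has a zero factor. *)
rewrite [X in _ + X]big1 ?addr0; last first.
  move=> s /forallPn[x nx]; rewrite (bigD1 x) //= hermitian_randicE.
  by rewrite phase_nadj // !mul0r mulr0.
rewrite (partition_big (@perm_graph n) predT) //= [RHS]big_mkcond.
apply: eq_bigr => H _.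
have [s /andP[/forallP adj_s /eqP <-]|noperm] :=
    pickP (fun s : {perm 'I_n} => [forall x, adj (underlying M) x (s x)] &&
                                  (perm_graph s == H)).
  rewrite -sum_perm_graph //; apply: eq_bigl => t; apply/andP/eqP => [[_ /eqP[]] //|e].
  split; last by rewrite /perm_graph e.
  apply/forallP=> x; rewrite -mem_underlying_edges.
  have: [set x; t x] \in perm_edges s by rewrite -e; apply: imset_f.
  by case/imsetP=> y _ ->; rewrite mem_underlying_edges.
(* No permutation traces [H], so [H] cannot be spanning elementary and both sides are 0. *)
rewrite big_pred0 //; case: ifP => // /and4P[Hsub /eqP HT elem _].
have [s HE adj_s] := elementary_perm_graph Hsub HT elem.
by have := noperm s; rewrite HE eqxx andbT => /forallP[].
Qed.
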